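(* For bivalued additive preferences, i.e., when $v_{i,j}\in\{x,y\}$ for all agents $i$ and items $j$, for fixed $x,y\in\mathbb R_{\ge 0}$, there exist DSIC, non-dictatorial mechanisms that output Pareto efficient allocations.
   Context: Setting: a set of $m$ indivisible items $[m]$ is to be allocated among $n$ agents $[n]$. Each agent $i$ has a private valuation vector $\mathbf v_i=(v_{i,1},\dots,v_{i,m})$. An allocation is $\mathbf x\in\{0,1\}^{n\times m}$ with $\sum_i x_{i,j}=1$ for every item $j$, and utilities are additive: $u_i(\mathbf x)=\sum_j v_{i,j}x_{i,j}$. A mechanism is an allocation function that maps the agents' reported valuations $\mathbf b=(\mathbf b_1,\dots,\mathbf b_n)$ to an allocation $\mathbf x(\mathbf b)$. DSIC (dominant strategy incentive compatible): for every agent $i$, true valuation $\mathbf v_i$, report $\mathbf b_i$ and reports $\mathbf b_{-i}$ of the other agents, $u_i(\mathbf x(\mathbf v_i,\mathbf b_{-i}))\ge u_i(\mathbf x(\mathbf b_i,\mathbf b_{-i}))$, where $u_i$ is computed with $\mathbf v_i$. Pareto efficient: an allocation $\mathbf x$ is Pareto efficient if there is no allocation $\mathbf y$ with $u_i(\mathbf y)\ge u_i(\mathbf x)$ for all $i$ and $u_j(\mathbf y)>u_j(\mathbf x)$ for some $j$. Non-dictatorial: not a serial dictatorship. The paper describes serial dictatorship for two agents: one fixed agent (the dictator) is always allocated all the items for which she has a positive value, and the other agent receives the leftovers (items valued zero by both agents are allocated in some arbitrary deterministic manner).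
   Formalization: Proved for at least two agents, at least one item, x and y not both zero, and, when there is only one item, at least three agents and x ≠ y; in the excluded cases every DSIC mechanism with Pareto efficient outputs is dictatorial (trivially so with no items or all-zero values). *)

(* Defs.v *)
From mathcomp Require Import all_boot all_order all_algebra.

Set Implicit Arguments.
Unset Strict Implicit.
Unset Printing Implicit Defensive.

Import Order.TTheory GRing.Theory Num.Theory.
Local Open Scope ring_scope.

Definition allocation (n m : nat) : Type :=
  {a : 'M[bool]_(n, m) | [forall j : 'I_m, (\sum_(i < n) a i j)%N == 1%N]}.

Definition receives (n m : nat) (a : allocation n m) (i : 'I_n) (j : 'I_m) :
  bool := val a i j.

Definition utility (R : realFieldType) (n m : nat)
    (v : 'rV[R]_m) (i : 'I_n) (a : allocation n m) : R :=
  \sum_(j < m) v 0 j * (receives a i j)%:R.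

(* Row i of a profile is the valuation vector reported by agent i. A mechanism
   is a total function on real profiles; the properties below only constrain
   it on the bivalued ones, so its values elsewhere are irrelevant. *)
Definition mechanism (R : realFieldType) (n m : nat) : Type :=
  'M[R]_(n, m) -> allocation n m.

(* The number of rows k is 1 for a single valuation vector and n for a
   profile. *)
Definition bivalued (R : realFieldType) (x y : R) (k m : nat)
    (b : 'M[R]_(k, m)) : Prop :=
  forall (i : 'I_k) (j : 'I_m), b i j = x \/ b i j = y.

(* The profile (w, b_{-i}). *)
Definition with_report (R : realFieldType) (n m : nat)
    (b : 'M[R]_(n, m)) (i : 'I_n) (w : 'rV[R]_m) : 'M[R]_(n, m) :=
  \matrix_(k < n, j < m) (if k == i then w 0 j else b k j).

Definition DSIC (R : realFieldType) (x y : R) (n m : nat)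
    (M : mechanism R n m) : Prop :=
  forall (i : 'I_n) (v w : 'rV[R]_m) (b : 'M[R]_(n, m)),
    bivalued x y v -> bivalued x y w -> bivalued x y b ->
    utility v i (M (with_report b i w)) <= utility v i (M (with_report b i v)).

Definition pareto_efficient (R : realFieldType) (n m : nat)
    (v : 'M[R]_(n, m)) (a : allocation n m) : Prop :=
  ~ exists c : allocation n m,
      (forall i : 'I_n, utility (row i v) i a <= utility (row i v) i c) /\
      (exists i : 'I_n, utility (row i v) i a < utility (row i v) i c).

Definition outputs_pareto_efficient (R : realFieldType) (x y : R) (n m : nat)
    (M : mechanism R n m) : Prop :=
  forall v : 'M[R]_(n, m), bivalued x y v -> pareto_efficient v (M v).

(* A fixed agent d always gets every item she values positively, and the
   leftovers go to the other agents; items nobody values are unconstrained.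
   For n = 2 this is serial dictatorship. For n > 2 nothing is required of how
   the other agents share the leftovers: every serial dictatorship along a
   priority order of the agents is included, so negating this notion rules all
   of those out. *)
Definition dictatorial (R : realFieldType) (x y : R) (n m : nat)
    (M : mechanism R n m) : Prop :=
  exists d : 'I_n, forall b : 'M[R]_(n, m), bivalued x y b ->
    forall j : 'I_m,
      (0 < b d j -> receives (M b) d j) /\
      (b d j = 0 -> (exists i : 'I_n, 0 < b i j) -> ~~ receives (M b) d j).

(* Main.v *)
Require Import Defs.
From mathcomp Require Import all_boot all_order all_algebra.
From mathcomp Require Import lra.

Set Implicit Arguments.
Unset Strict Implicit.
Unset Printing Implicit Defensive.

Import Order.TTheory GRing.Theory Num.Theory.
Local Open Scope ring_scope.

(* Assume [x <= y]; Pareto efficiency always comes from maximizing a positively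
   weighted sum of utilities.
   - If [x = 0], give each item to some agent valuing it, if there is one, the
     choice depending only on the reports for that item. Hiding a positive value
     wins an item only if nobody else values it, so every such rule is DSIC, and
     the choice can be made so that there is no dictator.
   - If [0 < x] and there are several items, agent 0 gets her favourite item,
     with ties broken in favour of agent 1, who receives all the others.
   - If [0 < x] and there is one item, the report of agent 0 decides which of
     the agents 1 and 2 receives it. *)

(** * Allocations given by the owner of each item, and weighted welfare *)

Lemma alloc_of_subproof (n m : nat) (g : 'I_m -> 'I_n) :
  [forall j : 'I_m,
     (\sum_(i < n) (\matrix_(i < n, j < m) (g j == i)) i j)%N == 1%N].
Proof.
apply/forallP => j; rewrite (bigD1 (g j)) //= mxE eqxx big1 // => i.
by rewrite mxE eq_sym => /negbTE ->.
Qed.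

Definition alloc_of (n m : nat) (g : 'I_m -> 'I_n) : allocation n m :=
  exist (fun a : 'M[bool]_(n, m) => [forall j, (\sum_(i < n) a i j)%N == 1%N])
    _ (alloc_of_subproof g).

Lemma receives_alloc_of (n m : nat) (g : 'I_m -> 'I_n) i j :
  receives (alloc_of g) i j = (g j == i).
Proof. by rewrite /receives /= mxE. Qed.

Lemma utility_alloc_of (R : realFieldType) (n m : nat) (g : 'I_m -> 'I_n)
    (v : 'rV[R]_m) i :
  utility v i (alloc_of g) = \sum_(j | g j == i) v 0 j.
Proof.
rewrite /utility [RHS]big_mkcond; apply: eq_bigr => j _ /=.
by rewrite receives_alloc_of; case: eqP => _; rewrite ?mulr1 ?mulr0.
Qed.

Lemma weighted_welfare (R : realFieldType) (n m : nat) (l : 'I_n -> R)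
    (b : 'M[R]_(n, m)) (c : allocation n m) :
  \sum_i l i * utility (row i b) i c =
  \sum_j \sum_i l i * b i j * (receives c i j)%:R.
Proof.
rewrite exchange_big; apply: eq_bigr => i _; rewrite mulr_sumr.
by apply: eq_bigr => j _; rewrite mxE mulrA.
Qed.

(** A Pareto improvement would strictly raise the welfare weighted by [l]. That welfare splits over
    the items, and [g] already gives each item to an agent of largest weighted value. *)
Lemma pareto_of_weights (R : realFieldType) (n m : nat) (l : 'I_n -> R)
    (b : 'M[R]_(n, m)) (g : 'I_m -> 'I_n) :
  (forall i, 0 < l i) -> (forall i j, l i * b i j <= l (g j) * b (g j) j) ->
  pareto_efficient b (alloc_of g).
Proof.
move=> l_gt0 g_max [c [c_ge [i0 c_gt]]].
have: \sum_i l i * utility (row i b) i (alloc_of g) <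
      \sum_i l i * utility (row i b) i c.
  rewrite (bigD1 i0) //= [ltRHS](bigD1 i0) //= ltr_leD ?ltr_pM2l //.
  by apply: ler_sum => i _; rewrite ler_pM2l.
rewrite ltNge !weighted_welfare => /negP; apply; apply: ler_sum => j _.
rewrite [leRHS](bigD1 (g j)) //= receives_alloc_of eqxx mulr1.
rewrite [X in _ + X]big1 ?addr0 => [|i]; last first.
  by rewrite receives_alloc_of eq_sym => /negbTE ->; rewrite mulr0.
(* Under [c] the item contributes an average of weighted values, which is at most their maximum. *)
have c_sum1 : \sum_i (receives c i j)%:R = 1 :> R.
  by rewrite -natr_sum; move/forallP/(_ j)/eqP: (valP c) => ->.
rewrite -[leRHS]mulr1 -[X in _ <= _ * X]c_sum1 mulr_sumr.
by apply: ler_sum => i _; apply: ler_wpM2r; rewrite ?ler0n.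
Qed.

Section Rules.
Variables (R : realFieldType) (n m : nat) (x y : R).
Implicit Types (b : 'M[R]_(n, m)) (g : 'M[R]_(n, m) -> 'I_m -> 'I_n).

Lemma bivalued_const_mx k : bivalued x y (const_mx y : 'M[R]_(k, m)).
Proof. by move=> i j; right; rewrite mxE. Qed.

Lemma bivalued_with_report b i (w : 'rV[R]_m) :
  bivalued x y b -> bivalued x y w -> bivalued x y (with_report b i w).
Proof. by move=> bb bw k j; rewrite mxE; case: eqP. Qed.

(** Everyone values [j] at [b], so its owner [g b j] is the only possible dictator; at [b'] this
    agent misses the valued item [j']. *)
Lemma not_dictatorial g b b' j j' :
  bivalued x y b -> bivalued x y b' -> (forall i, 0 < b i j) ->
  0 < b' (g b j) j' -> g b' j' != g b j ->
  ~ dictatorial x y (fun b => alloc_of (g b)).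
Proof.
move=> bb bb' b_gt0 b'_gt0 g_neq [d dP].
have [/(_ (b_gt0 d)) + _] := dP b bb j.
rewrite receives_alloc_of => /eqP gd.
rewrite gd in b'_gt0 g_neq; have [/(_ b'_gt0) + _] := dP b' bb' j'.
by rewrite receives_alloc_of (negbTE g_neq).
Qed.

End Rules.

(** * Smaller value zero: rules deciding each item separately *)

Section ZeroValue.
Variables (R : realFieldType) (n m : nat) (y : R) (y_gt0 : 0 < y).
Variable G : 'I_m -> 'cV[R]_n -> 'I_n.
Hypothesis G_gt0 : forall j (c : 'cV[R]_n) i, 0 < c i 0 -> 0 < c (G j c) 0.

Let rule (b : 'M[R]_(n, m)) (j : 'I_m) := G j (col j b).

Lemma columnwise_DSIC : DSIC 0 y (fun b => alloc_of (rule b)).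
Proof.
move=> i v w b bv bw _; rewrite !utility_alloc_of.
rewrite big_mkcond [leRHS]big_mkcond /=; apply: ler_sum => j _.
have [->|vj] := bv 0 j; first by rewrite !if_same.
have [wj|wj] := bw 0 j; last first.
  rewrite /rule; suff -> : col j (with_report b i w) = col j (with_report b i v).
    by [].
  by apply/colP => k; rewrite !mxE vj wj.
case: (eqVneq _ i) => [gw|_]; last by case: ifP => // _; rewrite vj ltW.
case: (eqVneq _ i) => // gv.
(* Truth loses the item to an agent valuing it. With the lie 0, [i] could then not win it, as
   someone still reports a positive value. *)
have := @G_gt0 j (col j (with_report b i v)) i.
rewrite -/(rule _ _) !mxE eqxx vj (negbTE gv) => /(_ y_gt0) bk.
have := @G_gt0 j (col j (with_report b i w)) (rule (with_report b i v) j).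
rewrite -/(rule _ _) gw !mxE eqxx wj ltxx (negbTE gv).
by move=> /(_ bk).
Qed.

Lemma columnwise_pareto :
  outputs_pareto_efficient 0 y (fun b => alloc_of (rule b)).
Proof.
move=> b bb; apply: (@pareto_of_weights _ _ _ (fun=> 1)) => // i j.
rewrite !mul1r.
have := @G_gt0 j (col j b) i; rewrite !mxE -/(rule b j).
case: (bb i j) (bb (rule b j) j) => -> [] -> // gP; first exact: ltW.
by have := gP y_gt0; rewrite ltxx.
Qed.

End ZeroValue.

Definition prefer (R : realFieldType) (n : nat) (p : 'I_n) (c : 'cV[R]_n) :=
  if 0 < c p 0 then p else odflt p [pick i | 0 < c i 0].

Lemma prefer_gt0 (R : realFieldType) (n : nat) (p : 'I_n) (c : 'cV[R]_n) i :
  0 < c i 0 -> 0 < c (prefer p c) 0.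
Proof.
move=> ci; rewrite /prefer; case: ifP => // _.
by case: pickP => //= /(_ i); rewrite ci.
Qed.

Lemma preferE (R : realFieldType) (n : nat) (p : 'I_n) (c : 'cV[R]_n) :
  0 < c p 0 -> prefer p c = p.
Proof. by rewrite /prefer => ->. Qed.

(** * Positive values, several items *)

Section Quota.
Variables (R : realFieldType) (n m : nat) (x y : R).
Hypotheses (x_gt0 : 0 < x) (le_xy : x <= y).
Variables (a0 a1 : 'I_n) (a01 : a0 != a1) (j0 : 'I_m).
Implicit Types b : 'M[R]_(n, m).

(* On [{x, y}], maximizing [2 s - t] amounts to maximizing [s] and, among the
   maximizers, minimizing [t]. *)
Definition favourite (b : 'M[R]_(n, m)) : 'I_m :=
  [arg max_(k > j0) (2 * b a0 k - b a1 k)]%O.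

Definition quota_rule b j := if j == favourite b then a0 else a1.

Lemma favouriteP b k :
  2 * b a0 k - b a1 k <= 2 * b a0 (favourite b) - b a1 (favourite b).
Proof. by rewrite /favourite; case: arg_maxP => // i _; apply. Qed.

Lemma utility_quota0 (v : 'rV[R]_m) b :
  utility v a0 (alloc_of (quota_rule b)) = v 0 (favourite b).
Proof.
rewrite utility_alloc_of (big_pred1 (favourite b)) // => j.
by rewrite /quota_rule /=; case: (j == _); rewrite ?eqxx // eq_sym (negbTE a01).
Qed.

Lemma utility_quota1 (v : 'rV[R]_m) b :
  utility v a1 (alloc_of (quota_rule b)) = \sum_j v 0 j - v 0 (favourite b).
Proof.
rewrite utility_alloc_of [in RHS](bigD1 (favourite b)) //= [RHS]addrC addKr.
apply: eq_bigl => j.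
by rewrite /quota_rule; case: (j == _); rewrite ?eqxx // (negbTE a01).
Qed.

Lemma utility_quota2 (v : 'rV[R]_m) b i : i != a0 -> i != a1 ->
  utility v i (alloc_of (quota_rule b)) = 0.
Proof.
move=> i0 i1; rewrite utility_alloc_of big_pred0 // => j.
by rewrite /quota_rule eq_sym; case: ifP => _; apply: negbTE.
Qed.

Lemma quota_DSIC : DSIC x y (fun b => alloc_of (quota_rule b)).
Proof.
move=> i v w b bv bw bb; have a10 : a1 != a0 by rewrite eq_sym.
have [->|i0] := eqVneq i a0.
  rewrite !utility_quota0; set f := favourite _; set f' := favourite _.
  (* The term of [a1] varies by at most [y - x], too little to offset a gap [2 * (y - x)] in the
     term of [a0]. *)
  have := favouriteP (with_report b a0 v) f; rewrite -/f'.
  rewrite !mxE eqxx (negbTE a10).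
  by case: (bv 0 f) (bv 0 f') (bb a1 f) (bb a1 f') => -> [] -> [] -> [] ->; lra.
have [->|i1] := eqVneq i a1; last by rewrite !utility_quota2.
rewrite !utility_quota1 lerD2l lerN2.
set f := favourite _; set f' := favourite _.
(* Whatever [a1] reports, the favourite has maximal value for [a0]. So [f] and [f'] tie for [a0],
   and the truthful tie-break loses [a1] an item of least value. *)
have := favouriteP (with_report b a1 v) f'; rewrite -/f.
have := favouriteP (with_report b a1 w) f; rewrite -/f'.
rewrite !mxE eqxx (negbTE a01).
case: (bv 0 f) (bv 0 f') (bb a0 f) (bb a0 f') => -> [] -> [] -> [] ->;
by case: (bw 0 f) (bw 0 f') => -> [] ->; lra.
Qed.

Lemma quota_pareto :
  outputs_pareto_efficient x y (fun b => alloc_of (quota_rule b)).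
Proof.
move=> b bb; set f := favourite b; have y_gt0 := lt_le_trans x_gt0 le_xy.
have b_ge i j : x <= b i j by case: (bb i j) => ->.
have b_le i j : b i j <= y by case: (bb i j) => ->.
have b_gt0 i j : 0 < b i j := lt_le_trans x_gt0 (b_ge i j).
(* Weighted by the values of the favourite item to the other of the two agents,
   its two values agree, and every other item is worth at least as much to
   [a1]; the last weight is too small to matter. *)
apply: (@pareto_of_weights _ _ _ (fun i =>
  if i == a0 then y * b a1 f else if i == a1 then y * b a0 f else x * x)).
  by move=> i; do 2?case: ifP => _; rewrite mulr_gt0.
move=> i j; have a10 : a1 != a0 by rewrite eq_sym.
have fP := favouriteP b j; rewrite -/f in fP.
(* If [f] and [j] tie for [a0], this is the tie-break; otherwise [b a0 j = x] and [b a0 f = y], and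
   the factors compare one by one. *)
have exch : b a1 f * b a0 j <= b a0 f * b a1 j.
  have := le_xy; rewrite le_eqVlt => /orP[/eqP x_y|lt_xy]; move: fP.
    by case: (bb a0 j) (bb a1 j) (bb a0 f) (bb a1 f) => -> [] -> [] -> [] ->;
      rewrite -?x_y.
  case: (bb a0 j) (bb a1 j) (bb a0 f) (bb a1 f) => -> [] -> [] -> [] ->;
    first [lra | by move=> _; apply: ler_pM => //; apply: ltW].
have small k : x * x * b i j <= y * b k f * b a1 j.
  have x_ge0 := ltW x_gt0; rewrite -[leRHS]mulrA [leRHS]mulrC.
  by apply: ler_pM; rewrite ?mulr_ge0 ?ler_pM ?(ltW (b_gt0 i j)).
rewrite /quota_rule -/f; case: (eqVneq j f) => [jf|_] /=; rewrite eqxx ?(negbTE a10).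
  have := small a0; rewrite jf [y * b a1 f * _]mulrAC => small0.
  case: ifP => [/eqP ->|_]; first by rewrite mulrAC.
  by case: ifP => [/eqP ->|_].
case: ifP => [/eqP -> |_]; first by rewrite -!mulrA ler_pM2l.
by case: ifP => [/eqP ->|_].
Qed.

(** One profile suffices: when all values are [y], two items that everyone values go to different
    agents. *)
Lemma quota_not_dictatorial j1 : j1 != j0 ->
  ~ dictatorial x y (fun b => alloc_of (quota_rule b)).
Proof.
move=> j10; set b := const_mx y : 'M[R]_(n, m).
have y_gt0 := lt_le_trans x_gt0 le_xy.
have [j jf] : exists j, j != favourite b.
  by have [<-|] := eqVneq j0 (favourite b); [exists j1 | exists j0].
apply: (@not_dictatorial _ _ _ _ _ _ b b (favourite b) j);
  rewrite /quota_rule ?eqxx ?(negbTE jf) ?mxE //; last by rewrite eq_sym.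
- exact: bivalued_const_mx.
- exact: bivalued_const_mx.
- by move=> i; rewrite mxE.
Qed.

End Quota.

(** * Positive values, one item *)

Section SingleItem.
Variables (R : realFieldType) (n m : nat) (x y : R).
Hypotheses (x_gt0 : 0 < x) (lt_xy : x < y) (m1 : m = 1%N).
Variables (a0 a1 a2 : 'I_n).
Hypotheses (a01 : a0 != a1) (a02 : a0 != a2) (a12 : a1 != a2).
Implicit Types b : 'M[R]_(n, m).

Definition switch_rule (b : 'M[R]_(n, m)) j := if b a0 j == y then a1 else a2.

(** The only report that is read is that of [a0], who never receives anything. *)
Lemma switch_DSIC : DSIC x y (fun b => alloc_of (switch_rule b)).
Proof.
move=> i v w b _ _ _; rewrite !utility_alloc_of.
have [->|i0] := eqVneq i a0.
  rewrite !big_pred0 // => j; rewrite /switch_rule;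
  by case: ifP => _; rewrite eq_sym; apply: negbTE.
rewrite le_eqVlt; apply/orP; left; apply/eqP; apply: eq_bigl => j.
by rewrite /switch_rule !mxE [a0 == i]eq_sym (negbTE i0).
Qed.

(** Weight [y] for the owner and [x] for the others works, since all values lie between [x] and
    [y]. *)
Lemma switch_pareto :
  outputs_pareto_efficient x y (fun b => alloc_of (switch_rule b)).
Proof.
move=> b bb; have y_gt0 := lt_trans x_gt0 lt_xy.
have [j0 j0P] : exists j0 : 'I_m, forall j, j = j0.
  by subst m; exists ord0 => j; rewrite ord1.
apply: (@pareto_of_weights _ _ _ (fun i =>
  if i == switch_rule b j0 then y else x)) => [i|i j]; first by case: ifP.
rewrite (j0P j) eqxx; case: ifP => [/eqP -> //|_].
have b_ge k : x <= b k j0 by case: (bb k j0) => ->; rewrite // ltW.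
have b_le : b i j0 <= y by case: (bb i j0) => ->; rewrite // ltW.
rewrite [leRHS]mulrC; apply: ler_pM => //; first exact: ltW.
exact: le_trans (ltW x_gt0) (b_ge i).
Qed.

Lemma switch_not_dictatorial :
  ~ dictatorial x y (fun b => alloc_of (switch_rule b)).
Proof.
have y_gt0 := lt_trans x_gt0 lt_xy.
have j : 'I_m by rewrite m1; exact: ord0.
apply: (@not_dictatorial _ _ _ _ _ _ (const_mx y) (const_mx x) j j);
  rewrite /switch_rule ?mxE ?eqxx ?(lt_eqF lt_xy) //.
- exact: bivalued_const_mx.
- by move=> i k; left; rewrite mxE.
- by move=> i; rewrite mxE.
- by rewrite eq_sym.
Qed.

End SingleItem.

(** * Choice of the mechanism in each case *)

Lemma exists_zero_value (R : realFieldType) (n m : nat) (y : R)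
    (y_gt0 : 0 < y) (n_gt1 : (1 < n)%N) (m_gt0 : (0 < m)%N)
    (single_item : m = 1%N -> (2 < n)%N) :
  exists M : mechanism R n m,
    [/\ DSIC 0 y M, ~ dictatorial 0 y M & outputs_pareto_efficient 0 y M].
Proof.
pose a0 := Ordinal (ltnW n_gt1); pose a1 := Ordinal n_gt1.
pose j0 := Ordinal m_gt0.
have [m_gt1|m_le1] := ltnP 1 m.
  pose G (j : 'I_m) (c : 'cV[R]_n) := prefer (if j == j0 then a0 else a1) c.
  have G_gt0 j (c : 'cV[R]_n) i : 0 < c i 0 -> 0 < c (G j c) 0 by apply: prefer_gt0.
  exists (fun b => alloc_of (fun j => G j (col j b))); split.
  - exact: columnwise_DSIC.
  - apply: (@not_dictatorial _ _ _ _ _ _ (const_mx y) (const_mx y)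
      j0 (Ordinal m_gt1)); rewrite /G ?preferE ?mxE //.
    + exact: bivalued_const_mx.
    + exact: bivalued_const_mx.
    + by move=> i; rewrite mxE.
  - exact: columnwise_pareto.
have n_gt2 : (2 < n)%N by apply: single_item; apply/eqP; rewrite eqn_leq m_le1.
pose a2 := Ordinal n_gt2.
pose G (j : 'I_m) (c : 'cV[R]_n) := prefer (if 0 < c a0 0 then a1 else a2) c.
have G_gt0 j (c : 'cV[R]_n) i : 0 < c i 0 -> 0 < c (G j c) 0 by apply: prefer_gt0.
exists (fun b => alloc_of (fun j => G j (col j b))); split.
- exact: columnwise_DSIC.
(* When [a0] switches from [y] to 0, the item passes from [a1] to [a2], although [a1] still values
   it. *)
- apply: (@not_dictatorial _ _ _ _ _ _ (const_mx y)
    (\matrix_(i, j) if i == a0 then 0 else y) j0 j0);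
    rewrite /G ?preferE ?mxE ?y_gt0 ?eqxx ?ltxx //.
  + exact: bivalued_const_mx.
  + by move=> i j; rewrite mxE; case: ifP; [left|right].
  + by move=> i; rewrite mxE.
- exact: columnwise_pareto.
Qed.

Lemma exists_positive_values (R : realFieldType) (n m : nat) (x y : R)
    (x_gt0 : 0 < x) (le_xy : x <= y) (n_gt1 : (1 < n)%N) (m_gt0 : (0 < m)%N)
    (single_item : m = 1%N -> (2 < n)%N /\ x <> y) :
  exists M : mechanism R n m,
    [/\ DSIC x y M, ~ dictatorial x y M & outputs_pareto_efficient x y M].
Proof.
pose a0 := Ordinal (ltnW n_gt1); pose a1 := Ordinal n_gt1.
have [m_gt1|m_le1] := ltnP 1 m.
  pose j0 := Ordinal m_gt0.
  exists (fun b => alloc_of (quota_rule a0 a1 j0 b)); split.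
  - exact: quota_DSIC.
  - by apply: (@quota_not_dictatorial _ _ _ _ _ _ _ _ _ _ _ (Ordinal m_gt1)).
  - exact: quota_pareto.
have m1 : m = 1%N by apply/eqP; rewrite eqn_leq m_le1.
have [n_gt2 /eqP neq_xy] := single_item m1.
have lt_xy : x < y by rewrite lt_neqAle neq_xy.
exists (fun b => alloc_of (switch_rule y a0 a1 (Ordinal n_gt2) b)); split.
- exact: switch_DSIC.
- exact: switch_not_dictatorial.
- exact: switch_pareto.
Qed.

(* The hypotheses on n, m, x, y beyond nonnegativity exclude exactly the
   degenerate instances in which every mechanism that is DSIC and outputs
   Pareto efficient allocations is dictatorial: fewer than two agents, no item,
   all values zero, or a single item with only two agents or only one value. *)
Theorem proposition2 (R : realFieldType) (n m : nat) (x y : R)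
    (x_ge0 : 0 <= x) (y_ge0 : 0 <= y)
    (n_gt1 : (1 < n)%N) (m_gt0 : (0 < m)%N)
    (xy_neq0 : ~ (x = 0 /\ y = 0))
    (single_item : m = 1%N -> (2 < n)%N /\ x <> y) :
  exists M : mechanism R n m,
    [/\ DSIC x y M, ~ dictatorial x y M & outputs_pareto_efficient x y M].
Proof.
wlog le_xy : x y x_ge0 y_ge0 xy_neq0 single_item / x <= y => [xy_case|].
  case/orP: (le_total x y) => [/xy_case|le_yx]; first exact.
  have biC k (b : 'M[R]_(k, m)) : bivalued x y b -> bivalued y x b.
    by move=> bb i j; apply/or_comm/bb.
  have biC' k (b : 'M[R]_(k, m)) : bivalued y x b -> bivalued x y b.
    by move=> bb i j; apply/or_comm/bb.
  have [||M [ds nd pe]] := xy_case y x y_ge0 x_ge0 _ _ le_yx.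
  - by case=> y0 x0; apply: xy_neq0.
  - by move=> /single_item [? /nesym].
  exists M; split.
  - by move=> i v w b bv bw bb; apply: ds; apply: biC.
  - case=> d dP; apply: nd; exists d => b bb; exact: dP (biC' _ _ bb).
  - by move=> b bb; exact: pe (biC _ _ bb).
have [x_gt0|x_le0] := ltP 0 x; first exact: exists_positive_values.
have x0 : x = 0 by apply/le_anti; rewrite x_le0.
rewrite {}x0 in xy_neq0 single_item *; apply: exists_zero_value => //.
  by rewrite lt_def y_ge0 andbT; apply/eqP => y0; apply: xy_neq0.
by move=> /single_item [].
Qed.
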